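(* Let $\Gamma=(V,E,D,t,o)$ be a finite mixed graph (i.e. $V$ is finite) without an oriented cycle. Then the twisted right-angled Artin group $G_\Gamma$ is poly-free.
   Context: A mixed graph $\Gamma$ is a quintuple $(V,E,D,t,o)$ where $V$ is a non-empty set whose elements are called vertices; $E\subseteq\{\{x,y\} : x,y\in V,\ x\neq y\}$ is a set of two-element subsets of $V$, called edges; $D\subseteq E$ is a subset whose elements are called oriented edges; and $o,t\colon D\to V$ are functions such that $e=\{o(e),t(e)\}$ for all $e\in D$. An oriented edge $e\in D$ with $o(e)=a$, $t(e)=b$ is denoted $[a,b\rangle$; an edge $\{a,b\}\in E\setminus D$ is denoted $[a,b]$. The twisted right-angled Artin group based on $\Gamma$ is the group $G_\Gamma$ with generating set $V$ and with one defining relation for each edge: for each $\{a,b\}\in E\setminus D$ the relation $aba^{-1}b^{-1}=1$, and for each $e=[a,b\rangle\in D$ (so $o(e)=a$, $t(e)=b$) the relation $abab^{-1}=1$ (equivalently $bab^{-1}=a^{-1}$). An oriented cycle on $\Gamma$ is a sequence $e_0,\dots,e_n\in D$ such that $t(e_i)=o(e_{i+1})$ for $0\le i<n$ and $t(e_n)=o(e_0)$. A group $G$ is poly-free if there exists a finite sequence of subgroups $G_0=\{1\}\unlhd G_1\unlhd G_2\unlhd\dots\unlhd G_n=G$ (each normal in the next) such that each quotient $G_{i+1}/G_i$ is a free group (of arbitrary rank). *)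

(* Defs.v *)
From HB Require Import structures.
From mathcomp Require Import all_boot.
From mathcomp Require Import boolp.

Set Implicit Arguments.
Unset Strict Implicit.
Unset Printing Implicit Defensive.

Local Open Scope group_scope.
Local Open Scope quotient_scope.

(* The groups below are the possibly infinite groups [groupType] of monoid.v,
   and the subgroups of [G : groupType] are the predicates [groupClosed G]. *)

Section Presentation.
Variable X : choiceType.

(* [(x, false)] is the letter x and [(x, true)] is the letter x^-1. *)
Definition word := seq (X * bool).

Definition gen (x : X) : X * bool := (x, false).
Definition geni (x : X) : X * bool := (x, true).
Definition letter_inv (l : X * bool) := (l.1, ~~ l.2).
Definition word_inv (w : word) : word := rev (map letter_inv w).

Variable R : word -> Prop.

(* The least congruence on words that makes the two letters of each generator
   inverse to each other and every relator trivial. *)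
Inductive word_eq : word -> word -> Prop :=
| word_eq_refl w : word_eq w w
| word_eq_sym u v : word_eq u v -> word_eq v u
| word_eq_trans u v w : word_eq u v -> word_eq v w -> word_eq u w
| word_eq_cat u u' v v' :
    word_eq u u' -> word_eq v v' -> word_eq (u ++ v) (u' ++ v')
| word_eq_cancel l : word_eq [:: l; letter_inv l] [::]
| word_eq_relator r : R r -> word_eq r [::].

Definition word_eqb : rel word := fun u v => `[< word_eq u v >].

Lemma word_eqb_refl : reflexive word_eqb.
Proof. by move=> u; apply/asboolP; exact: word_eq_refl. Qed.

Lemma word_eqb_sym : symmetric word_eqb.
Proof. by move=> u v; apply/asboolP/asboolP; exact: word_eq_sym. Qed.

Lemma word_eqb_trans : transitive word_eqb.
Proof.
by move=> v u w /asboolP uv /asboolP vw; apply/asboolP; exact: word_eq_trans vw.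
Qed.

Canonical word_equiv :=
  EquivRel word_eqb word_eqb_refl word_eqb_sym word_eqb_trans.

Definition presented_group := {eq_quot word_equiv}.

HB.instance Definition _ := Choice.on presented_group.
HB.instance Definition _ := EqQuotient.on presented_group.

Definition pres_mk (w : word) : presented_group := \pi_presented_group w.

Lemma pres_mkP u v : pres_mk u = pres_mk v <-> word_eq u v.
Proof.
split=> [/eqquotP/asboolP //|uv].
by apply/eqquotP/asboolP.
Qed.

Definition pres_one : presented_group := pres_mk [::].
Definition pres_mul (x y : presented_group) : presented_group :=
  pres_mk (repr x ++ repr y).
Definition pres_inv (x : presented_group) : presented_group :=
  pres_mk (word_inv (repr x)).

Lemma pres_mkK x : pres_mk (repr x) = x.
Proof. exact: reprK. Qed.

Lemma word_eq_repr u : word_eq (repr (pres_mk u)) u.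
Proof. by apply/pres_mkP; rewrite pres_mkK. Qed.

Lemma pres_mk_cat u v : pres_mk (u ++ v) = pres_mul (pres_mk u) (pres_mk v).
Proof.
by apply/pres_mkP/word_eq_cat; apply: word_eq_sym; exact: word_eq_repr.
Qed.

Lemma word_invK : involutive word_inv.
Proof.
move=> w; rewrite /word_inv map_rev revK -map_comp -[RHS]map_id.
by apply: eq_map => -[x b]; rewrite /letter_inv /= negbK.
Qed.

Lemma word_eq_mulV w : word_eq (w ++ word_inv w) [::].
Proof.
elim: w => [|l w IHw] /=; first exact: word_eq_refl.
rewrite /word_inv /= rev_cons -cats1 catA -cat1s.
apply: word_eq_trans (word_eq_cancel l).
rewrite -cat1s -[X in word_eq _ X]cat1s.
apply: word_eq_cat (word_eq_refl _) _.
rewrite -[X in word_eq _ X]cat0s.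
exact: word_eq_cat IHw (word_eq_refl _).
Qed.

Lemma word_eq_mulVl w : word_eq (word_inv w ++ w) [::].
Proof. by rewrite -{2}[w]word_invK; exact: word_eq_mulV. Qed.

Lemma pres_mulA : associative pres_mul.
Proof.
move=> x y z; rewrite -[x]pres_mkK -[y]pres_mkK -[z]pres_mkK.
by rewrite -!pres_mk_cat catA.
Qed.

Lemma pres_mul1g : left_id pres_one pres_mul.
Proof. by move=> x; rewrite -[x]pres_mkK -pres_mk_cat. Qed.

Lemma pres_mulg1 : right_id pres_one pres_mul.
Proof. by move=> x; rewrite -[x]pres_mkK -pres_mk_cat cats0. Qed.

Lemma pres_mulVg : left_inverse pres_one pres_inv pres_mul.
Proof.
move=> x; rewrite -{2}[x]pres_mkK -pres_mk_cat.
by apply/pres_mkP; exact: word_eq_mulVl.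
Qed.

Lemma pres_mulgV : right_inverse pres_one pres_inv pres_mul.
Proof.
move=> x; rewrite -{1}[x]pres_mkK -pres_mk_cat.
by apply/pres_mkP; exact: word_eq_mulV.
Qed.

HB.instance Definition _ := isGroup.Build presented_group
  pres_mulA pres_mul1g pres_mulg1 pres_mulVg pres_mulgV.

End Presentation.

Definition free_group (X : choiceType) : groupType :=
  presented_group (fun _ : word X => False).

(* The rank of a free group is arbitrary, hence [X] is any choiceType. *)
Definition is_free (G : groupType) : Prop :=
  exists (X : choiceType) (f : free_group X -> G),
    {morph f : x y / x * y} /\ bijective f.

Section Subgroup.
Variables (G : groupType) (H : groupClosed G).

Definition subgroup := {x : G | x \in H}.

HB.instance Definition _ := SubChoice.on subgroup.

Lemma subgroup_closed : group_closed H.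
Proof. by split; [exact: gpred1 | exact: gpredF]. Qed.

HB.instance Definition _ :=
  SubChoice_isSubGroup.Build G _ subgroup subgroup_closed.

End Subgroup.

Definition normal_in (G : groupType) (K H : groupClosed G) : Prop :=
  {subset K <= H} /\ {in K & H, forall x y, x ^ y \in K}.

Section Quotient.
Variables (G : groupType) (K H : groupClosed G).

Definition coset_eq : rel (subgroup H) := fun x y => (val x)^-1 * val y \in K.

Lemma coset_eq_refl : reflexive coset_eq.
Proof. by move=> x; rewrite /coset_eq mulVg gpred1. Qed.

Lemma coset_eq_sym : symmetric coset_eq.
Proof. by move=> x y; rewrite /coset_eq -gpredV invgM invgK. Qed.

Lemma coset_eq_trans : transitive coset_eq.
Proof.
move=> y x z xy yz.
by rewrite /coset_eq -[val z](mulVKg (val y)) mulgA gpredM.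
Qed.

Canonical coset_equiv :=
  EquivRel coset_eq coset_eq_refl coset_eq_sym coset_eq_trans.

(* The type H / K; the proof [nKH] is an argument because the group structure
   below depends on it. *)
Definition quotient_group (nKH : normal_in K H) := {eq_quot coset_equiv}.

Variable nKH : normal_in K H.

HB.instance Definition _ := Choice.on (quotient_group nKH).
HB.instance Definition _ := EqQuotient.on (quotient_group nKH).

Definition coset_mk (x : subgroup H) : quotient_group nKH :=
  \pi_(quotient_group nKH) x.

Lemma coset_mkP x y : coset_mk x = coset_mk y <-> (val x)^-1 * val y \in K.
Proof. by split=> [/eqquotP|xy] //; apply/eqquotP. Qed.

Lemma coset_mkK x : coset_mk (repr x) = x.
Proof. exact: reprK. Qed.

Definition quot_one : quotient_group nKH := coset_mk 1.
Definition quot_mul (x y : quotient_group nKH) : quotient_group nKH :=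
  coset_mk (repr x * repr y).
Definition quot_inv (x : quotient_group nKH) : quotient_group nKH :=
  coset_mk (repr x)^-1.

Lemma coset_mkM x y : coset_mk (x * y) = quot_mul (coset_mk x) (coset_mk y).
Proof.
apply/coset_mkP; rewrite !gmulfM.
set x' := repr (coset_mk x); set y' := repr (coset_mk y).
have Kx : (val x)^-1 * val x' \in K by apply/coset_mkP; rewrite coset_mkK.
have Ky : (val y)^-1 * val y' \in K by apply/coset_mkP; rewrite coset_mkK.
have -> : (val x * val y)^-1 * (val x' * val y')
    = ((val x)^-1 * val x') ^ val y * ((val y)^-1 * val y').
  by rewrite /conjg invgM !mulgA mulgK.
by rewrite gpredM// nKH.2// (valP y).
Qed.

Lemma coset_mkV x : coset_mk x^-1 = quot_inv (coset_mk x).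
Proof.
apply/coset_mkP; rewrite !gmulfV invgK.
set x' := repr (coset_mk x).
have Kx : (val x')^-1 * val x \in K by apply/coset_mkP; rewrite coset_mkK.
have -> : val x * (val x')^-1 = ((val x')^-1 * val x) ^ (val x')^-1.
  by rewrite /conjg invgK !mulgA mulgV mul1g.
by rewrite nKH.2// gpredV (valP x').
Qed.

Lemma quot_mulA : associative quot_mul.
Proof.
move=> x y z; rewrite -[x]coset_mkK -[y]coset_mkK -[z]coset_mkK.
by rewrite -!coset_mkM mulgA.
Qed.

Lemma quot_mul1g : left_id quot_one quot_mul.
Proof. by move=> x; rewrite -[x]coset_mkK -coset_mkM mul1g. Qed.

Lemma quot_mulg1 : right_id quot_one quot_mul.
Proof. by move=> x; rewrite -[x]coset_mkK -coset_mkM mulg1. Qed.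

Lemma quot_mulVg : left_inverse quot_one quot_inv quot_mul.
Proof. by move=> x; rewrite -[x]coset_mkK -coset_mkV -coset_mkM mulVg. Qed.

Lemma quot_mulgV : right_inverse quot_one quot_inv quot_mul.
Proof. by move=> x; rewrite -[x]coset_mkK -coset_mkV -coset_mkM mulgV. Qed.

HB.instance Definition _ := isGroup.Build (quotient_group nKH)
  quot_mulA quot_mul1g quot_mulg1 quot_mulVg quot_mulgV.

End Quotient.

Definition poly_free (G : groupType) : Prop :=
  exists (n : nat) (H : nat -> groupClosed G),
    [/\ forall x, (x \in H 0) = (x == 1),
        forall x, x \in H n
      & forall i, i < n ->
          exists nH : normal_in (H i) (H i.+1), is_free (quotient_group nH)].

(* A mixed graph with finitely many vertices. *)
Record mixed_graph := MixedGraph {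
  vertex :> finType;
  vertex_nonempty : 0 < #|vertex|;
  edges : {set {set vertex}};
  edgesP : forall e, e \in edges -> exists x y, x != y /\ e = [set x; y];
  oriented : {set {set vertex}};
  oriented_sub : oriented \subset edges;
  origin : {e : {set vertex} | e \in oriented} -> vertex;
  terminus : {e : {set vertex} | e \in oriented} -> vertex;
  orientedP : forall e : {e : {set vertex} | e \in oriented},
    val e = [set origin e; terminus e]
}.

Definition oriented_edge (Gamma : mixed_graph) :=
  {e : {set Gamma} | e \in oriented Gamma}.

(* In [path.cycle] the last item of the sequence is followed by the first. *)
Definition oriented_cycle (Gamma : mixed_graph)
    (c : seq (oriented_edge Gamma)) : Prop :=
  c <> [::] /\ cycle (fun e f => terminus e == origin f) c.

(* An unoriented edge {a, b} contributes the relators of both (a, b) and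
   (b, a), which are inverse to each other. *)
Inductive traag_relator (Gamma : mixed_graph) : word Gamma -> Prop :=
| traag_unoriented (a b : Gamma) :
    [set a; b] \in edges Gamma :\: oriented Gamma ->
    traag_relator [:: gen a; gen b; geni a; geni b]
| traag_oriented (e : oriented_edge Gamma) :
    traag_relator
      [:: gen (origin e); gen (terminus e); gen (origin e); geni (terminus e)].

Definition traag (Gamma : mixed_graph) : groupType :=
  presented_group (@traag_relator Gamma).

(* Main.v *)
(** An acyclic orientation has a source: a vertex [v] that is not the terminus
    of an oriented edge. Every relation involving [v] then reads [b v b^-1 = v]
    or [b v b^-1 = v^-1], so killing [v] retracts [G] onto the group [Q] of the
    other vertices, and the signs extend to a homomorphism from [Q] to {1, -1}.
    The twisted conjugates [(q v q^-1)^(sign q)] are permuted by the twisted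
    action of [Q]; letting [Q] act in this way on the free group over this
    orbit, one identifies [G] with the semidirect product of that free group by
    [Q], so the kernel of [G -> Q] is free. The series of [Q] pulls back to [G],
    and one concludes by induction on the number of vertices. *)

From HB Require Import structures.
Require Import Defs.
From mathcomp Require Import all_boot.
From mathcomp Require Import boolp.

Set Implicit Arguments.
Unset Strict Implicit.
Unset Printing Implicit Defensive.

Local Open Scope group_scope.
Local Open Scope quotient_scope.

(** * Powers with exponent 1 or -1, the exponent being encoded by a boolean *)

Definition sgn (G : groupType) (b : bool) (x : G) : G := if b then x^-1 else x.

Lemma sgnD (G : groupType) (b c : bool) (x : G) :
  sgn (b (+) c) x = sgn b (sgn c x).
Proof. by case: b c => [] []; rewrite /sgn ?invgK. Qed.

Lemma sgnK (G : groupType) (b : bool) : involutive (@sgn G b).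
Proof. by move=> x; rewrite -sgnD addbb. Qed.

Lemma gmulf_sgn (G H : groupType) (f : UMagmaMorphism.type G H) b x :
  f (sgn b x) = sgn b (f x).
Proof. by case: b; rewrite //= gmulfV. Qed.

Lemma sgnJ (G : groupType) b (x y : G) : sgn b x ^ y = sgn b (x ^ y).
Proof. by case: b; rewrite //= conjVg. Qed.

Lemma gmulf_morphism (G H : groupType) (f : UMagmaMorphism.type G H) :
  monoid_morphism f.
Proof. by split; [exact: gmulf1|exact: gmulfM]. Qed.

Lemma comp_morphism (G H K : groupType) (f : H -> K) (g : G -> H) :
  monoid_morphism f -> monoid_morphism g -> monoid_morphism (f \o g).
Proof. by move=> fM gM; split=> [|x y]; rewrite /= gM fM. Qed.

(** * Presented groups *)

Section PresentedGroup.
Variables (X : choiceType) (R : word X -> Prop).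

Definition pres_gen (x : X) : presented_group R := pres_mk R [:: gen x].

Section Lift.
Variables (K : groupType) (f : X -> K).

Definition word_eval (w : word X) : K := \prod_(l <- w) sgn l.2 (f l.1).

Lemma word_eval_cat u v : word_eval (u ++ v) = word_eval u * word_eval v.
Proof.
rewrite /word_eval.
elim: u => [|l u IHu]; first by rewrite big_nil mul1g.
by rewrite !big_cons IHu mulgA.
Qed.

Hypothesis fR : forall r, R r -> word_eval r = 1.

Lemma word_eval_eq u v : word_eq R u v -> word_eval u = word_eval v.
Proof.
elim=> [//|{}u {}v _ -> //|{}u {}v w _ -> _ -> //| | |r /fR ->].
- by move=> u1 u2 v1 v2 _ e1 _ e2; rewrite !word_eval_cat e1 e2.
- case=> x [] /=; rewrite /word_eval !big_cons big_nil /= mulg1.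
  + by rewrite mulVg.
  + by rewrite mulgV.
- by rewrite /word_eval big_nil.
Qed.

(** The proof is an argument so that the morphism instance below can refer to it. *)
Definition pres_lift of (forall r, R r -> word_eval r = 1) :=
  fun x : presented_group R => word_eval (repr x).

Lemma pres_lift_mk w : pres_lift fR (pres_mk R w) = word_eval w.
Proof. exact/word_eval_eq/word_eq_repr. Qed.

Lemma pres_lift_gen x : pres_lift fR (pres_gen x) = f x.
Proof. by rewrite pres_lift_mk /word_eval big_seq1. Qed.

Lemma pres_lift_morphism : monoid_morphism (pres_lift fR).
Proof.
split; first by rewrite [LHS]pres_lift_mk /word_eval big_nil.
move=> x y; rewrite -[x]pres_mkK -[y]pres_mkK.
by rewrite -[_ * _]pres_mk_cat !pres_lift_mk word_eval_cat.
Qed.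

HB.instance Definition _ :=
  isUMagmaMorphism.Build _ _ (pres_lift fR) pres_lift_morphism.

End Lift.

Lemma pres_mkV w : pres_mk R (word_inv w) = (pres_mk R w)^-1.
Proof.
by apply/esym/mulg1_eq; rewrite -[LHS]pres_mk_cat; apply/pres_mkP/word_eq_mulV.
Qed.

Lemma pres_mkE w : pres_mk R w = word_eval pres_gen w.
Proof.
rewrite /word_eval; elim: w => [|l w IHw]; first by rewrite big_nil.
rewrite big_cons -IHw -cat1s pres_mk_cat; apply: (congr2 (@pres_mul X R)) => //.
by case: l => x [] //; rewrite /= -pres_mkV.
Qed.

Lemma pres_gen_relator r : R r -> word_eval pres_gen r = 1.
Proof. by move=> Rr; rewrite -pres_mkE; apply/pres_mkP/word_eq_relator. Qed.

Lemma gmulf_word_eval (G K : groupType) (f : UMagmaMorphism.type G K)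
    (h : X -> G) w :
  f (word_eval h w) = word_eval (f \o h) w.
Proof. by rewrite gmulf_prod; apply: eq_bigr => l _; rewrite gmulf_sgn. Qed.

(** Every element is the evaluation of a word in the generators, and morphisms commute with
    evaluation. *)
Lemma pres_morphism_ext (K : groupType) (f g : presented_group R -> K) :
  monoid_morphism f -> monoid_morphism g ->
  (forall x, f (pres_gen x) = g (pres_gen x)) -> f =1 g.
Proof.
move=> fM gM fg x.
pose f' : UMagmaMorphism.type (presented_group R) K :=
  HB.pack_for (UMagmaMorphism.type _ _) f (isUMagmaMorphism.Build _ _ f fM).
pose g' : UMagmaMorphism.type (presented_group R) K :=
  HB.pack_for (UMagmaMorphism.type _ _) g (isUMagmaMorphism.Build _ _ g gM).
rewrite -[x]pres_mkK pres_mkE -[f]/(f' : _ -> _) -[g]/(g' : _ -> _).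
rewrite !gmulf_word_eval; apply: eq_bigr => l _; congr sgn; exact: fg.
Qed.

End PresentedGroup.

(** * Poly-freeness of split extensions *)

(* Requiring [f] to be a morphism only modulo [K] lets [f] pick arbitrary coset
   representatives, so that a basis need not be lifted. *)
Lemma is_free_quotientP (G : groupType) (K H : groupClosed G)
    (nKH : normal_in K H) :
  is_free (quotient_group nKH) <->
  exists (X : choiceType) (f : free_group X -> G),
    [/\ forall w, f w \in H,
        forall u w, (f (u * w))^-1 * (f u * f w) \in K,
        forall w, f w \in K -> w = 1
      & forall x, x \in H -> exists w, (f w)^-1 * x \in K].
Proof.
split=> [[X [f [fM [g fK gK]]]]|[X [f [fH fM f1 fsurj]]]].
- have f1 : f 1 = 1 by apply: (mulgI (f 1)); rewrite -fM !mulg1.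
  pose h w := val (repr (f w)).
  have hE w y : (h w)^-1 * val y \in K <-> f w = coset_mk nKH y.
    by rewrite -[X in X = _]coset_mkK; apply: iff_sym; exact: coset_mkP.
  exists X, h; split=> [w|u w|w Kw|x Hx].
  + exact: (valP (repr (f w))).
  + apply/(hE _ (repr (f u) * repr (f w))).
    by rewrite coset_mkM !coset_mkK fM.
  + apply: (can_inj fK); rewrite f1.
    by apply/(hE w 1); rewrite gmulf1 mulg1 gpredV.
  + exists (g (coset_mk nKH (exist _ x Hx))).
    by apply/(hE _ (exist _ x Hx)); rewrite gK.
- pose g w := coset_mk nKH (exist _ (f w) (fH w)).
  have gM : {morph g : x y / x * y}.
    by move=> u w; rewrite /g -[RHS]coset_mkM; apply/coset_mkP; exact: fM.
  have g1 : g 1 = 1 by apply: (mulgI (g 1)); rewrite -gM !mulg1.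
  have gV w : g w^-1 = (g w)^-1.
    by apply: (mulgI (g w)); rewrite -gM !mulgV.
  have ginj : injective g.
    move=> u w uw; have : g (u / w) = 1 by rewrite gM gV uw mulgV.
    move/esym/coset_mkP; rewrite gmulf1 invg1 mul1g /= => /f1.
    exact: divg1_eq.
  have gsurj y : exists w, g w == y.
    rewrite -[y]coset_mkK; case: (fsurj _ (valP (repr y))) => w Kw.
    by exists w; apply/eqP/coset_mkP.
  exists X, g; split=> //.
  (* [bijective] asks for an inverse function, obtained here by choosing preimages. *)
  exists (fun y => xchoose (gsurj y)) => [w|y].
  + by apply: ginj; apply/eqP; exact: (xchooseP (gsurj _)).
  + by apply/eqP; exact: (xchooseP (gsurj _)).
Qed.

Definition pack_closed (G : groupType) (S : {pred G}) (clS : group_closed S) :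
    groupClosed G :=
  HB.pack_for (groupClosed G) S
    (isInvClosed.Build G S (group_closedV clS))
    (isMul1Closed.Build G S clS.1)
    (isMulClosed.Build G S (group_closedM clS)).

Section TrivialAndPreimage.
Variables (G Q : groupType) (p : UMagmaMorphism.type G Q) (H : groupClosed Q).

Lemma trivial_closed : group_closed (pred1 (1 : G)).
Proof.
by split=> [|x y]; rewrite ?inE // => /eqP -> /eqP ->; rewrite mulgV.
Qed.

Definition trivial_subgroup : groupClosed G := pack_closed trivial_closed.

Lemma mem_trivial x : (x \in trivial_subgroup) = (x == 1).
Proof. by []. Qed.

Lemma preimage_closed : group_closed [pred x | p x \in H].
Proof.
split=> [|x y]; rewrite !inE; first by rewrite gmulf1 gpred1.
by move=> Hx Hy; rewrite gmulfF gpredF.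
Qed.

Definition preimage_subgroup : groupClosed G := pack_closed preimage_closed.

Lemma mem_preimage x : (x \in preimage_subgroup) = (p x \in H).
Proof. by []. Qed.

End TrivialAndPreimage.

Lemma poly_free_trivial (G : groupType) : (forall x : G, x = 1) -> poly_free G.
Proof.
move=> G1; exists 0, (fun=> trivial_subgroup G).
by split=> // x; rewrite (G1 x) gpred1.
Qed.

(** The trivial subgroup is put below the preimages of the series of [Q]. The preimage of the bottom
    term is the kernel of [p], free through [f]; each later quotient is the corresponding one for
    [Q], since [p] has the section [s]. *)
Lemma poly_free_split (G Q : groupType) (p : UMagmaMorphism.type G Q)
    (s : UMagmaMorphism.type Q G) (X : choiceType)
    (f : UMagmaMorphism.type (free_group X) G) :
  cancel s p -> injective f ->
  (forall w, p (f w) = 1) -> (forall x, p x = 1 -> exists w, f w = x) ->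
  poly_free Q -> poly_free G.
Proof.
move=> sK finj pf fker [n [H [H0 Hn Hfree]]].
exists n.+1, (fun i => if i is j.+1 then preimage_subgroup p (H j)
                       else trivial_subgroup G).
split=> [x|x|[|i] ltin] //.
- exact: Hn.
- have nK : normal_in (trivial_subgroup G) (preimage_subgroup p (H 0)).
    split=> [x|x y]; rewrite !(mem_trivial, mem_preimage) => /eqP ->.
      by rewrite gmulf1 gpred1.
    by rewrite conj1g.
  exists nK; apply/is_free_quotientP; exists X, f.
  split=> [w|u w|w|x]; rewrite !(mem_trivial, mem_preimage).
  + by rewrite pf gpred1.
  + by rewrite gmulfM mulVg.
  + by move=> /eqP fw1; apply: finj; rewrite fw1 gmulf1.
  + rewrite H0 => /eqP/fker[w <-]; exists w.
    by rewrite (mem_trivial, mem_preimage) mulVg.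
- have [[sH nH] /is_free_quotientP[Y [g [gH gM g1 gsurj]]]] := Hfree i ltin.
  have nK :
      normal_in (preimage_subgroup p (H i)) (preimage_subgroup p (H i.+1)).
    split=> [x|x y]; rewrite !(mem_trivial, mem_preimage); first exact: sH.
    by move=> Hx Hy; rewrite gmulfJ nH.
  (* [s] carries coset representatives from [Q] to [G]; membership is tested after [p], which
     cancels [s]. *)
  exists nK; apply/is_free_quotientP; exists Y, (s \o g).
  split=> [w|u w|w|x]; rewrite !(mem_trivial, mem_preimage) /=.
  + by rewrite sK.
  + by rewrite !(gmulfM, gmulfV) !sK.
  + by rewrite sK => /g1.
  + by move=> /gsurj[w Kw]; exists w; rewrite mem_preimage gmulfM gmulfV sK.
Qed.

(** * Semidirect products *)

(** A right action: [q * r] acts by [q] first, as conjugation [x ^ (q * r)] does. *)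
Record group_action (Q N : groupType) := GroupAction {
  act :> Q -> UMagmaMorphism.type N N;
  act1 : forall x, act 1 x = x;
  actM : forall q r x, act (q * r) x = act r (act q x)
}.

Section SemidirectProduct.
Variables (Q N : groupType) (a : group_action Q N).

Definition semidirect of group_action Q N := (Q * N)%type.
Local Notation P := (semidirect a).

HB.instance Definition _ := Choice.on P.

Definition sd_pair (q : Q) (x : N) : P := (q, x).
(** The pair of [q] and [x] stands for the product [q x]; moving [r] to the left past [x] replaces
    [x] by [x ^ r]. *)
Definition sd_mul (u w : P) : P := sd_pair (u.1 * w.1) (a w.1 u.2 * w.2).
Definition sd_inv (u : P) : P := sd_pair u.1^-1 (a u.1^-1 u.2)^-1.

Lemma sd_mulA : associative sd_mul.
Proof. by move=> u w t; rewrite /sd_mul /= actM gmulfM !mulgA. Qed.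

Lemma sd_mul1 : left_id (sd_pair 1 1) sd_mul.
Proof. by case=> q x; rewrite /sd_mul /= gmulf1 !mul1g. Qed.

Lemma sd_mulr1 : right_id (sd_pair 1 1) sd_mul.
Proof. by case=> q x; rewrite /sd_mul /= act1 !mulg1. Qed.

Lemma sd_mulV : left_inverse (sd_pair 1 1) sd_inv sd_mul.
Proof.
by case=> q x; rewrite /sd_mul /= gmulfV -actM mulVg act1 mulVg.
Qed.

Lemma sd_mulrV : right_inverse (sd_pair 1 1) sd_inv sd_mul.
Proof. by case=> q x; rewrite /sd_mul /= !mulgV. Qed.

HB.instance Definition _ := isGroup.Build P
  sd_mulA sd_mul1 sd_mulr1 sd_mulV sd_mulrV.

Definition sd_fst (u : P) : Q := u.1.
Definition sd_inl (q : Q) : P := sd_pair q 1.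
Definition sd_inr (x : N) : P := sd_pair 1 x.

Lemma sd_fst_morphism : monoid_morphism sd_fst.
Proof. by []. Qed.

Lemma sd_inl_morphism : monoid_morphism sd_inl.
Proof.
by split=> // q r; rewrite [RHS]/(sd_mul _ _) /sd_mul /= gmulf1 mulg1.
Qed.

Lemma sd_inr_morphism : monoid_morphism sd_inr.
Proof.
by split=> // x y; rewrite [RHS]/(sd_mul _ _) /sd_mul /= act1 mulg1.
Qed.

HB.instance Definition _ := isUMagmaMorphism.Build P Q sd_fst sd_fst_morphism.
HB.instance Definition _ := isUMagmaMorphism.Build Q P sd_inl sd_inl_morphism.
HB.instance Definition _ := isUMagmaMorphism.Build N P sd_inr sd_inr_morphism.

Lemma sd_pairE q x : sd_pair q x = sd_inl q * sd_inr x.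
Proof. by rewrite [RHS]/(sd_mul _ _) /sd_mul /= gmulf1 mul1g mulg1. Qed.

Lemma sd_inrJ q x : sd_inr x ^ sd_inl q = sd_inr (a q x).
Proof.
rewrite conjgE -[X in _ * X]/(sd_mul _ _) /sd_mul /= mulg1 mul1g sd_pairE.
exact: mulKg.
Qed.

Lemma sd_inr_inj : injective sd_inr.
Proof. by move=> x y []. Qed.

Section SemidirectLift.
Variables (G : groupType) (s : UMagmaMorphism.type Q G).
Variables (f : UMagmaMorphism.type N G).

Definition sd_lift (u : P) : G := s u.1 * f u.2.

Lemma sd_lift_morphism :
  (forall q x, f (a q x) = f x ^ s q) -> monoid_morphism sd_lift.
Proof.
move=> fJ; split=> [|u w]; first by rewrite /sd_lift !gmulf1 mulg1.
by rewrite /sd_lift /= !gmulfM fJ conjgE !mulgA mulgK.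
Qed.

End SemidirectLift.

End SemidirectProduct.

(** * Universal property of free groups *)

Section FreeLift.
Variables (X : choiceType) (K : groupType) (f : X -> K).

Definition free_gen (x : X) : free_group X := pres_gen _ x.

Lemma free_lift_relator r : False -> word_eval f r = 1.
Proof. by []. Qed.

Definition free_lift : free_group X -> K := pres_lift free_lift_relator.

Lemma free_lift_morphism : monoid_morphism free_lift.
Proof. exact: pres_lift_morphism. Qed.

HB.instance Definition _ :=
  isUMagmaMorphism.Build _ _ free_lift free_lift_morphism.

Lemma free_lift_gen x : free_lift (free_gen x) = f x.
Proof. exact: pres_lift_gen. Qed.

End FreeLift.

Lemma free_morphism_ext (X : choiceType) (K : groupType)
    (f g : free_group X -> K) :
  monoid_morphism f -> monoid_morphism g ->
  (forall x, f (free_gen x) = g (free_gen x)) -> f =1 g.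
Proof. exact: pres_morphism_ext. Qed.

(** * Twisted conjugates of an element *)

Section TwistedConjugates.
Variables (G Q : groupType) (s : UMagmaMorphism.type Q G).
Variables (eps : Q -> bool) (v : G).
Hypothesis epsM : {morph eps : x y / x * y >-> x (+) y}.

Lemma eps1 : eps 1 = false.
Proof. by have := epsM 1 1; rewrite mulg1; case: (eps 1). Qed.

(** Inversion is not a morphism in general, so this is only an action of [Q] on the set [G]. *)
Definition twist (q : Q) (x : G) : G := sgn (eps q) (x ^ s q).

Lemma twist1 x : twist 1 x = x.
Proof. by rewrite /twist eps1 gmulf1 conjg1. Qed.

Lemma twistM q r x : twist (q * r) x = twist r (twist q x).
Proof. by rewrite /twist sgnJ -sgnD addbC -epsM gmulfM conjgM. Qed.

(** The basis consists of elements of [G], so that equal twisted conjugates of [v] give a single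
    letter. *)
Definition in_orbit : pred G := fun x => `[< exists q, x = twist q v >].
Definition twist_orbit : choiceType := {x : G | in_orbit x}.
Definition orbit_val (x : twist_orbit) : G := sval x.

Lemma orbit_val_inj : injective orbit_val.
Proof. exact: val_inj. Qed.

Lemma orbit_valP x : exists q, orbit_val x = twist q v.
Proof. exact/asboolP/(svalP x). Qed.

Lemma twist_orbit_proof q x : in_orbit (twist q (orbit_val x)).
Proof.
by have [r ->] := orbit_valP x; apply/asboolP; exists (r * q); rewrite twistM.
Qed.

Definition orbit_twist q x : twist_orbit :=
  exist in_orbit _ (twist_orbit_proof q x).

Lemma orbit_base_proof : in_orbit v.
Proof. by apply/asboolP; exists 1; rewrite twist1. Qed.

Definition orbit_base : twist_orbit := exist in_orbit v orbit_base_proof.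

Lemma orbit_twist1 x : orbit_twist 1 x = x.
Proof. by apply: orbit_val_inj; rewrite /= twist1. Qed.

Lemma orbit_twistM q r x :
  orbit_twist (q * r) x = orbit_twist r (orbit_twist q x).
Proof. by apply: orbit_val_inj; rewrite /= twistM. Qed.

Local Notation F := (free_group twist_orbit).

(** In [G], conjugation by [s q] sends an orbit element [x] to [twist q x] raised to the sign of
    [q], because signs are involutive. The formula copies this rule on letters. *)
Definition free_twist q : UMagmaMorphism.type F F :=
  free_lift (fun x => sgn (eps q) (free_gen (orbit_twist q x))).

Lemma free_twist_gen q x :
  free_twist q (free_gen x) = sgn (eps q) (free_gen (orbit_twist q x)).
Proof. exact: free_lift_gen. Qed.

Lemma free_twist1 w : free_twist 1 w = w.
Proof.
move: w; apply: (free_morphism_ext (gmulf_morphism _)) => // x.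
by rewrite free_twist_gen eps1 orbit_twist1.
Qed.

Lemma free_twistM q r w : free_twist (q * r) w = free_twist r (free_twist q w).
Proof.
move: w; apply: (free_morphism_ext (gmulf_morphism _) (comp_morphism
  (gmulf_morphism (free_twist r)) (gmulf_morphism (free_twist q)))) => x.
rewrite /= !free_twist_gen gmulf_sgn free_twist_gen -sgnD epsM.
by rewrite orbit_twistM addbC.
Qed.

Definition twist_action := GroupAction free_twist1 free_twistM.
Local Notation P := (semidirect twist_action).

Definition orbit_lift : UMagmaMorphism.type F G := free_lift orbit_val.

Lemma orbit_lift_gen x : orbit_lift (free_gen x) = orbit_val x.
Proof. exact: free_lift_gen. Qed.

Lemma conjg_morphism (x : G) : monoid_morphism (conjg^~ x).
Proof. by split=> [|y z]; rewrite ?conj1g ?conjMg. Qed.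

Lemma orbit_liftJ q w : orbit_lift (twist_action q w) = orbit_lift w ^ s q.
Proof.
move: w; apply: (free_morphism_ext (comp_morphism (gmulf_morphism orbit_lift)
  (gmulf_morphism (free_twist q))) (comp_morphism (conjg_morphism (s q))
  (gmulf_morphism orbit_lift))) => x.
by rewrite /= free_twist_gen gmulf_sgn !orbit_lift_gen /= /twist sgnK.
Qed.

Definition twist_lift : P -> G := sd_lift s orbit_lift.

Lemma twist_lift_morphism : monoid_morphism twist_lift.
Proof. exact/sd_lift_morphism/orbit_liftJ. Qed.

(* If [G] maps to the semidirect product [P] compatibly with the obvious map
   back, then the kernel of [G -> Q] is the free factor of [P]. *)
Lemma poly_free_twist (f : UMagmaMorphism.type G P) :
  f v = sd_inr twist_action (free_gen orbit_base) ->
  (forall q, f (s q) = sd_inl twist_action q) ->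
  (forall x, twist_lift (f x) = x) ->
  poly_free Q -> poly_free G.
Proof.
move=> fv fs fK.
(* Thus [f] recovers the word from its image, which makes [orbit_lift] injective. *)
have fE w : f (orbit_lift w) = sd_inr twist_action w.
  move: w; apply: (free_morphism_ext (comp_morphism (gmulf_morphism f)
    (gmulf_morphism orbit_lift)) (gmulf_morphism (sd_inr twist_action))) => x.
  have [q xE] := orbit_valP x.
  (* Each letter is a translate of the base letter, so the values of [f] at [v] and on the section
     suffice. *)
  have -> : x = orbit_twist q orbit_base by apply: orbit_val_inj.
  rewrite /= orbit_lift_gen /= /twist gmulf_sgn gmulfJ fv fs sd_inrJ.
  by rewrite -gmulf_sgn /= free_twist_gen sgnK.
apply: (@poly_free_split _ _ (@sd_fst _ _ twist_action \o f) s _ orbit_lift).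
- by move=> q; rewrite /= fs.
- by move=> w t /(congr1 f); rewrite !fE => /sd_inr_inj.
- by move=> w; rewrite /= fE.
- move=> x fx; exists (f x).2; rewrite -[RHS]fK /twist_lift /sd_lift.
  by rewrite -[(f x).1]/(sd_fst (f x)) [sd_fst _]fx gmulf1 mul1g.
Qed.

End TwistedConjugates.

(** * Twisted right-angled Artin groups *)

Definition sign_group := bool.
HB.instance Definition _ := Choice.on sign_group.
HB.instance Definition _ := isGroup.Build sign_group
  addbA addFb addbF addbb addbb.

Section MixedGraph.
Variable Gamma : mixed_graph.

Definition arrow (a b : Gamma) : bool :=
  [exists e : oriented_edge Gamma, (origin e == a) && (terminus e == b)].

Definition plain (a b : Gamma) : bool :=
  [set a; b] \in edges Gamma :\: oriented Gamma.

Lemma plainC a b : plain a b = plain b a.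
Proof. by rewrite /plain setUC. Qed.

Lemma plain_irrefl a : plain a a = false.
Proof.
apply/negP => /setDP[/edgesP[x [y [xy]]] /setP aE _]; move/negP: xy; apply.
have := aE x; have := aE y.
by rewrite !inE !eqxx orbT /= !orbb => /eqP -> /eqP ->.
Qed.

Lemma arrow_plain a b : arrow a b -> ~~ plain a b.
Proof.
case/existsP=> e /andP[/eqP <- /eqP <-]; rewrite /plain inE negb_and negbK.
by rewrite -orientedP (valP e).
Qed.

(** [connect] provides walks of vertices, whereas [oriented_cycle] speaks of edges. The walk is
    nonempty so that there is a first edge. *)
Lemma arrow_path_edges a p : path arrow a p -> p != [::] ->
  exists e (c : seq (oriented_edge Gamma)),
    [/\ path (fun e f => terminus e == origin f) e c, origin e = a
      & terminus (last e c) = last a p].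
Proof.
elim: p a => [//|b p IHp] a /= /andP[/existsP[e /andP[/eqP oe /eqP te]] bp] _.
have [p0|p0] := eqVneq p [::]; first by exists e, [::]; rewrite p0.
have [f [c [fc of_ tf]]] := IHp b bp p0.
by exists e, (f :: c); rewrite /= te of_ eqxx.
Qed.

Hypothesis acyclic : ~ (exists c : seq (oriented_edge Gamma), oriented_cycle c).

Lemma arrow_acyclic a b : arrow a b -> ~~ connect arrow b a.
Proof.
move=> ab; apply/negP => /connectP[p bp ap]; apply: acyclic.
have [|//|e [c [ec oe te]]] := @arrow_path_edges a (b :: p).
  by rewrite /= ab.
exists (e :: c); split=> //.
by rewrite /= rcons_path ec te oe /= -ap eqxx.
Qed.

Lemma exists_source (A : {set Gamma}) : A != set0 ->
  exists2 v, v \in A & {in A, forall a, ~~ arrow a v}.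
Proof.
case/set0Pn=> a0 Aa0.
(* A vertex of [A] with fewest ancestors is a source: if [a] points to [v], the ancestors of [a] are
   ancestors of [v], while [v] itself is not an ancestor of [a]. *)
pose anc v := #|[pred x | connect arrow x v]|.
case: (arg_minnP anc Aa0) => v Av vmin; exists v => // a Aa; apply/negP => av.
have := vmin a Aa; rewrite leqNgt => /negP; apply.
apply/proper_card/properP; split.
  by apply/subsetP=> x; rewrite !inE => xa; apply: connect_trans (connect1 av).
by exists v; rewrite !inE ?connect0 // arrow_acyclic.
Qed.

(* Killing the generators outside [A] gives the group of the full subgraph on
   [A] without changing the type of generators. *)
Inductive sub_relator (A : {set Gamma}) : word Gamma -> Prop :=
| sub_plain a b : a \in A -> b \in A -> plain a b ->
    sub_relator A [:: gen a; gen b; geni a; geni b]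
| sub_arrow a b : a \in A -> b \in A -> arrow a b ->
    sub_relator A [:: gen a; gen b; gen a; geni b]
| sub_outside a : a \notin A -> sub_relator A [:: gen a].

Definition sub_traag (A : {set Gamma}) : groupType :=
  presented_group (sub_relator A).
Definition sub_gen A (a : Gamma) : sub_traag A := pres_gen (sub_relator A) a.

Lemma traag_setT : traag Gamma = sub_traag [set: Gamma].
Proof.
rewrite /traag /sub_traag.
(* Equal relator predicates give equal groups, so no isomorphism has to be transported. *)
suff -> : @traag_relator Gamma = sub_relator [set: Gamma] by [].
apply/funext => r; apply/propext; split.
- case=> [a b ab|e]; first by apply: sub_plain.
  by apply: sub_arrow => //; apply/existsP; exists e; rewrite !eqxx.
- case=> [a b _ _ ab|a b _ _ /existsP[e /andP[/eqP <- /eqP <-]]|a].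
  + exact: traag_unoriented.
  + exact: traag_oriented.
  + by rewrite inE.
Qed.

Definition respects (A : {set Gamma}) (K : groupType) (f : Gamma -> K) :=
  [/\ {in A &, forall a b, plain a b -> f a ^ f b = f a},
      {in A &, forall a b, arrow a b -> f a ^ f b = (f a)^-1}
    & forall a, a \notin A -> f a = 1].

(** The relator of an arrow says [b a b^-1 = a^-1]; conjugating by [b] and inverting gives
    [b^-1 a b = a^-1], the form in [respects]. *)
Lemma sub_relatorP (A : {set Gamma}) (K : groupType) (f : Gamma -> K) :
  (forall r, sub_relator A r -> word_eval f r = 1) <-> respects A f.
Proof.
have plainE a b : word_eval f [:: gen a; gen b; geni a; geni b] = 1 <->
    f a ^ f b = f a.
  rewrite /word_eval !big_cons big_nil /= !mulg1 mulgA -invgM.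
  split=> [/divg1_eq ab|ab]; first by rewrite conjgE ab mulKg.
  by rewrite [f a * f b]conjgC ab mulgV.
have arrowE a b : word_eval f [:: gen a; gen b; gen a; geni b] = 1 <->
    f a ^ f b = (f a)^-1.
  rewrite /word_eval !big_cons big_nil /= !mulg1 !mulgA.
  split=> [/divg1_eq ab|ab]; last by rewrite [f a * f b]conjgC ab mulgVK mulgV.
  apply: (mulIg (f a)); rewrite mulVg conjgE -!mulgA.
  by rewrite [X in _ * X]mulgA ab mulVg.
split=> [fR|[fp fa fo] r [a b Aa Ab ab|a b Aa Ab ab|a Aa]].
- split=> [a b Aa Ab ab|a b Aa Ab ab|a Aa].
  + exact/plainE/fR/sub_plain.
  + exact/arrowE/fR/sub_arrow.
  + by have := fR _ (sub_outside Aa); rewrite /word_eval big_seq1.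
- exact/plainE/fp.
- exact/arrowE/fa.
- by rewrite /word_eval big_seq1 fo.
Qed.

Lemma sub_gen_respects A : respects A (@sub_gen A).
Proof. apply/sub_relatorP => r; exact: pres_gen_relator. Qed.

Section Lift.
Variables (A : {set Gamma}) (K : groupType) (f : Gamma -> K).
Hypothesis fR : respects A f.

Definition sub_lift : UMagmaMorphism.type (sub_traag A) K :=
  pres_lift ((sub_relatorP A f).2 fR).

Lemma sub_lift_gen a : sub_lift (sub_gen A a) = f a.
Proof. exact: pres_lift_gen. Qed.

End Lift.

(** * Splitting off a source *)

Section Source.
Variables (A : {set Gamma}) (v : Gamma).
Hypotheses (Av : v \in A) (sv : {in A, forall a, ~~ arrow a v}).
Local Notation B := (A :\ v).
Local Notation G := (sub_traag A).
Local Notation Q := (sub_traag B).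

Definition source_section (a : Gamma) : G := if a == v then 1 else sub_gen A a.

Lemma source_section_respects : respects B source_section.
Proof.
have [gp ga go] := sub_gen_respects A.
split=> [a b|a b|a]; rewrite !inE /source_section; last first.
  by case: eqP => //= _; exact: go.
all: by move=> /andP[/negPf -> Aa] /andP[/negPf -> Ab] ab; auto.
Qed.

Definition source_sign (a : Gamma) : sign_group := (a \in B) && arrow v a.

(** The sign group is abelian of exponent 2, so both kinds of relation hold for any choice of
    signs. *)
Lemma source_sign_respects : respects B source_sign.
Proof.
split=> [a b _ _ _|a b _ _ _|a /negPf Ba]; last by rewrite /source_sign Ba.
  by rewrite /conjg /=; case: (source_sign a) (source_sign b) => [] [].
by rewrite /conjg /=; case: (source_sign a) (source_sign b) => [] [].
Qed.

Definition source_lift := sub_lift source_section_respects.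
Definition source_eps (q : Q) : bool := sub_lift source_sign_respects q.

Lemma source_epsM : {morph source_eps : x y / x * y >-> x (+) y}.
Proof. by move=> x y; rewrite /source_eps gmulfM. Qed.

Local Notation act := (twist_action source_lift (sub_gen A v) source_epsM).

Definition source_base :=
  free_gen (orbit_base source_lift (sub_gen A v) source_epsM).

(** The intended inverse of [twist_lift], on generators. *)
Definition source_split (a : Gamma) : semidirect act :=
  if a == v then sd_inr act source_base else sd_inl act (sub_gen B a).

(** The relation between [v] and [b] says that the twisted action of [b] fixes [v]. Hence the base
    letter is fixed as a letter, and conjugation contributes only the sign of [b]. *)
Lemma source_baseJ b : b \in A -> b != v -> plain v b || arrow v b ->
  sd_inr act source_base ^ sd_inl act (sub_gen B b) =
    sgn (arrow v b) (sd_inr act source_base).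
Proof.
move=> Ab bv vb; have [gp ga _] := sub_gen_respects A.
have epsb : source_eps (sub_gen B b) = arrow v b.
  by rewrite /source_eps sub_lift_gen /source_sign !inE bv Ab.
rewrite sd_inrJ [act _ _]free_twist_gen epsb gmulf_sgn.
congr (sgn _ (sd_inr act (free_gen _))); apply: orbit_val_inj.
rewrite /= /twist epsb sub_lift_gen /source_section (negPf bv).
case: (boolP (arrow v b)) vb => [/ga -> //|_] /=; first by rewrite invgK.
by rewrite orbF => /gp ->.
Qed.

(** Relations inside [B] hold in the factor [Q], those at [v] by [source_baseJ]. An arrow into [v],
    which that computation does not cover, is excluded because [v] is a source. *)
Lemma source_split_respects : respects A source_split.
Proof.
have [gp ga go] := sub_gen_respects B.
split=> [a b Aa Ab|a b Aa Ab|a Aa]; rewrite /source_split.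
- have [-> {a Aa}|av] := eqVneq a v; have [-> {b Ab}|bv] := eqVneq b v => ab.
  + by rewrite plain_irrefl in ab.
  + rewrite source_baseJ ?ab //; have := contraL (@arrow_plain v b) ab.
    by move/negPf => ->.
  (* Commutation is symmetric, so an unoriented edge from [a] to [v] reduces to the previous
     case. *)
  + apply/conjg_fixP; rewrite commg1_sym; apply/conjg_fixP.
    rewrite plainC in ab; rewrite source_baseJ ?ab //.
    by have := contraL (@arrow_plain v a) ab; move/negPf => ->.
  + by rewrite -gmulfJ gp // !inE ?av ?bv.
- have [-> {b Ab}|bv] := eqVneq b v => ab.
    by rewrite (negPf (sv Aa)) in ab.
  move: ab; have [-> {a Aa}|av] := eqVneq a v => ab.
  + by rewrite source_baseJ ?ab ?orbT.
  + by rewrite -gmulfJ ga ?gmulfV // !inE ?av ?bv.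
- have [av|av] := eqVneq a v; first by rewrite av Av in Aa.
  by rewrite go ?gmulf1 // !inE av.
Qed.

Lemma poly_free_source : poly_free Q -> poly_free G.
Proof.
have f_gen := sub_lift_gen source_split_respects.
apply: (poly_free_twist (f := sub_lift source_split_respects)).
- by rewrite f_gen /source_split eqxx.
- apply: (pres_morphism_ext (comp_morphism (gmulf_morphism
    (sub_lift source_split_respects)) (gmulf_morphism source_lift))) => [|a].
    exact: gmulf_morphism.
  rewrite /= -/(sub_gen B a) [source_lift _]sub_lift_gen /source_section.
  have [->|av] := eqVneq a v; last by rewrite f_gen /source_split (negPf av).
  have [_ _ go] := sub_gen_respects B.
  by rewrite go ?gmulf1 // !inE eqxx.
(* Both sides are morphisms, so it suffices that each generator of [G] returns to itself: [v]
   through the base letter, the others through [Q] and its section. *)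
- have liftM := comp_morphism
    (twist_lift_morphism source_lift (sub_gen A v) source_epsM)
    (gmulf_morphism (sub_lift source_split_respects)).
  apply: (pres_morphism_ext (g := idfun) liftM) => // a.
  rewrite /= -/(sub_gen A a) f_gen /source_split /twist_lift /sd_lift.
  have [->|av] := eqVneq a v; rewrite /= gmulf1 ?mul1g ?mulg1.
    by rewrite [LHS]free_lift_gen.
  by rewrite [LHS]sub_lift_gen /source_section (negPf av).
Qed.

End Source.

Lemma poly_free_sub_traag A : poly_free (sub_traag A).
Proof.
have [n] := ubnP #|A|; elim: n => // n IHn in A *; rewrite ltnS => leAn.
have [->|/exists_source[v Av sv]] := eqVneq A set0.
  (* When all generators are killed, the identity and the constant morphism agree on them. *)
  apply: poly_free_trivial; apply: (pres_morphism_ext (f := idfun)) => // [|a].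
    by split=> // x y; rewrite mulg1.
  by have [_ _ go] := sub_gen_respects set0; apply: go; rewrite inE.
apply: (poly_free_source Av sv); apply: IHn; apply: leq_trans leAn.
by rewrite [leqRHS](cardsD1 v) Av.
Qed.

End MixedGraph.

Theorem proposition3p4 (Gamma : mixed_graph) :
  ~ (exists c : seq (oriented_edge Gamma), oriented_cycle c) ->
  poly_free (traag Gamma).
Proof. by move=> acyclic; rewrite traag_setT; exact: poly_free_sub_traag. Qed.
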